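(* Let $X$ be a real Banach space with dual $X^*$, and let $h:X\times X^*\to\mathbb{R}\cup\{\pm\infty\}$ be proper and convex, such that \[ h(x,x^* )\geq \langle x,x^*\rangle \quad\text{and}\quad h^*(x^*,x)\geq \langle x,x^*\rangle \qquad \forall (x,x^* )\in X\times X^*. \] If \[ \bigcup_{\lambda>0}\lambda\,\mathrm{Pr}_X\,\mathrm{D}(h) \] is a closed subspace of $X$, then the operator \[ T:=\{(x,x^* )\in X\times X^*\;|\; h^*(x^*,x)=\langle x,x^*\rangle\} \] is maximal monotone and $\mathcal{J}h\in\mathcal{F}_T$.
   Context: $\langle x,x^*\rangle=x^*(x)$ denotes the duality product $\pi(x,x^* )$. $X$ is identified with its canonical image in $X^{**}$. For $h$ on $X\times X^*$, its Fenchel conjugate is $h^*(x^*,x^{**})=\sup_{(x,y^* )\in X\times X^*}\langle x,x^*\rangle+\langle y^*,x^{**}\rangle-h(x,y^* )$, a function on $X^*\times X^{**}$; $h^*(x^*,x)$ means its value at $(x^*,x)$ with $x\in X\subset X^{**}$. $\mathcal{J}h(x,x^* ):=h^*(x^*,x)$ for $(x,x^* )\in X\times X^*$. $\mathrm{D}(h)=\{(x,x^* ): h(x,x^* )<\infty\}$ is the effective domain, $h$ is proper if $\mathrm{D}(h)\neq\emptyset$, and $\mathrm{Pr}_X\,\mathrm{D}(h)=\{x\in X:\exists x^*\in X^*,\ (x,x^* )\in \mathrm{D}(h)\}$. An operator $T\subset X\times X^*$ is monotone if $\langle x-y,x^*-y^*\rangle\ge0$ for all $(x,x^* ),(y,y^*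 )\in T$, and maximal monotone if it is monotone and not properly contained in any monotone operator. For maximal monotone $T$, the Fitzpatrick family $\mathcal{F}_T$ is the set of functions $g:X\times X^*\to\mathbb{R}\cup\{\pm\infty\}$ that are convex and lower semicontinuous (in the strong topology of $X\times X^*$), satisfy $g(x,x^* )\ge\langle x,x^*\rangle$ for all $(x,x^* )$, and satisfy $g(x,x^* )=\langle x,x^*\rangle$ whenever $(x,x^* )\in T$. *)

(* Defs.v *)
From HB Require Import structures.
From mathcomp Require Import all_boot all_order all_algebra.
From mathcomp Require Import all_classical all_reals all_analysis.
Set Implicit Arguments. Unset Strict Implicit. Unset Printing Implicit Defensive.
Import Order.TTheory GRing.Theory Num.Theory.
Import numFieldNormedType.Exports.
Local Open Scope classical_set_scope.
Local Open Scope ring_scope.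

Section Duality.
Variables (R : realType) (X : normedModType R).

Record dual := Dual {
  dfun :> X -> R;
  dual_linear : forall (a : R) (x y : X), dfun (a *: x + y) = a * dfun x + dfun y;
  dual_cont : continuous dfun }.

Definition ddist (f g : dual) : \bar R :=
  ereal_sup [set (`|f x - g x|)%:E | x in [set x : X | `|x| <= 1]].

(* Convexity of an extended-real-valued function on X x Xstar (convex epigraph). *)
Definition convex_XX (g : X * dual -> \bar R) : Prop :=
  forall (p q r : X * dual) (l a b : R), 0 <= l <= 1 ->
    r.1 = l *: p.1 + (1 - l) *: q.1 ->
    (forall x, r.2 x = l * p.2 x + (1 - l) * q.2 x) ->
    (g p <= a%:E)%E -> (g q <= b%:E)%E ->
    (g r <= (l * a + (1 - l) * b)%:E)%E.

Definition lsc_XX (g : X * dual -> \bar R) : Prop :=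
  forall (p : X * dual) (t : R), (t%:E < g p)%E ->
    exists2 d : R, 0 < d & forall q : X * dual,
      `|q.1 - p.1| < d -> (ddist q.2 p.2 < d%:E)%E -> (t%:E < g q)%E.

(* Fenchel conjugate h-star evaluated at (xstar, x) with x in X viewed in the bidual;
   Jh(x, xstar) := h-star(xstar, x). *)
Definition Jconj (h : X * dual -> \bar R) (p : X * dual) : \bar R :=
  ereal_sup (range (fun q : X * dual =>
     ((p.2 q.1 + q.2 p.1)%:E - h q)%E)).

Definition effdom (h : X * dual -> \bar R) : set (X * dual) :=
  [set p | (h p < +oo)%E].

Definition proper_XX (h : X * dual -> \bar R) : Prop := effdom h !=set0.

Definition PrX (h : X * dual -> \bar R) : set X :=
  [set x | exists f : dual, effdom h (x, f)].

Definition cone_PrX (h : X * dual -> \bar R) : set X :=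
  [set x | exists2 l : R, 0 < l & exists2 y, PrX h y & x = l *: y].

Definition lin_subspace (C : set X) : Prop :=
  C 0 /\ forall (a : R) (x y : X), C x -> C y -> C (a *: x + y).

Definition monotone_op (T : set (X * dual)) : Prop :=
  forall p q : X * dual, T p -> T q -> 0 <= p.2 (p.1 - q.1) - q.2 (p.1 - q.1).

Definition maximal_monotone (T : set (X * dual)) : Prop :=
  monotone_op T /\
  forall S : set (X * dual), monotone_op S -> T `<=` S -> S = T.

Definition fitzpatrick_family (T : set (X * dual)) (g : X * dual -> \bar R) : Prop :=
  [/\ convex_XX g, lsc_XX g,
      (forall p : X * dual, ((p.2 p.1)%:E <= g p)%E) &
      (forall p : X * dual, T p -> g p = (p.2 p.1)%:E)].

End Duality.

(* Main.v *)
Require Import Defs.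
From HB Require Import structures.
From mathcomp Require Import all_boot all_order all_algebra.
From mathcomp Require Import all_classical all_reals all_analysis.
From mathcomp Require Import ring lra.
Import Order.TTheory GRing.Theory Num.Theory.
Import numFieldNormedType.Exports.
Local Open Scope classical_set_scope.
Local Open Scope ring_scope.

(** Write [V] for the closed subspace generated by [Pr_X D(h)].  For [y] in the
    core of [Pr_X D(h)] relative to [V] and [d] in [V], Fenchel duality between
    [h] and the function equal to [(t - 1)^2 / 2] at [y + t d] and to [+oo] off
    this line produces a point of [T] above that line.  Since the line is one-dimensional
    the dual solution lies in [X], not merely in the bidual.  If [(z, zs)] is monotonically
    related to [T], taking [y = 0 = d] gives [z] in [V], because [T] is
    invariant under translation by the annihilator of [V].  If moreover the
    inequality [h*(zs, z) <= <z, zs>] failed at some [(y, ys)], shrinking [y] towards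
    [0] would put it in the core without losing the failure; with [d = z - y]
    the point of [T] so obtained is [(z, p)] with [p - zs] orthogonal to [d], and
    [h*(p, z) <= <z, p>] contradicts the failure at [(y, ys)].

    The dual solution is obtained without lower semicontinuity of [h]: the
    duality problem is first solved with the dual variable of [h] and the parameter
    [t] truncated at [n], where the Hahn-Banach theorem applies with the norm bound [n];
    the solutions are pointwise bounded on [V], hence equicontinuous there, and their
    common bound allows one more application of Hahn-Banach without truncation. *)

(** * Linear and sublinear functionals *)

Definition linear_form {R : realType} {E : lmodType R} (f : E -> R) : Prop :=
  forall (a : R) (x y : E), f (a *: x + y) = a * f x + f y.

Definition sublinear {R : realType} {E : lmodType R} (q : E -> R) : Prop :=
  (forall x y, q (x + y) <= q x + q y) /\
  (forall c x, 0 < c -> q (c *: x) <= c * q x).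

Definition convex_rel {R : realType} {E : lmodType R} (A : E -> R -> Prop) :=
  forall (l : R) x y r s, 0 <= l <= 1 -> A x r -> A y s ->
    A (l *: x + (1 - l) *: y) (l * r + (1 - l) * s).

Section LinearForm.
Context {R : realType} {E : lmodType R} {f : E -> R}.
Hypothesis lf : linear_form f.

Lemma linear_formD x y : f (x + y) = f x + f y.
Proof. by have := lf 1 x y; rewrite scale1r mul1r. Qed.

Lemma linear_form0 : f 0 = 0.
Proof. by have := linear_formD 0 0; rewrite addr0 => h; lra. Qed.

Lemma linear_formZ a x : f (a *: x) = a * f x.
Proof. by have := lf a x 0; rewrite !addr0 linear_form0 addr0. Qed.

Lemma linear_formN x : f (- x) = - f x.
Proof. by rewrite -scaleN1r linear_formZ mulN1r. Qed.

Lemma linear_formB x y : f (x - y) = f x - f y.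
Proof. by rewrite linear_formD linear_formN. Qed.

End LinearForm.

(** * Hahn-Banach theorem in sandwich form *)

Section HahnBanach.
Context {R : realType} {E : lmodType R}.
Implicit Types (q p N : E -> R).

Lemma sublinear0 q : sublinear q -> q 0 = 0.
Proof.
move=> [_ h]; have := h 2 0; have := h 2^-1 0; rewrite !scaler0.
have h0 : (0 : R) < 2 by lra.
rewrite invr_gt0 => /(_ h0) h1 /(_ h0) h2.
by lra.
Qed.

Lemma sublinear_ge q x : sublinear q -> - q (- x) <= q x.
Proof.
move=> sq; have := sq.1 x (- x); rewrite subrr sublinear0 // => h; lra.
Qed.

(** Applied below to the infimum of a chain, to the comparison functional that proves additivity,
    and to the gauge of the sandwich theorem. *)
Lemma inf_sublinear (Q : E -> R -> Prop) :
  (forall x, exists r, Q x r) ->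
  (forall x, exists m, forall r, Q x r -> m <= r) ->
  (forall x y r s, Q x r -> Q y s -> exists2 t, Q (x + y) t & t <= r + s) ->
  (forall c x r, 0 < c -> Q x r -> Q (c *: x) (c * r)) ->
  let q := fun x => inf [set r | Q x r] in
  sublinear q /\ (forall x r, Q x r -> q x <= r).
Proof.
move=> Q0 Qb QD QZ q.
have lbq x r : Q x r -> q x <= r.
  move=> Qr; apply: ge_inf => //; have [m hm] := Qb x.
  by exists m => s /= /hm.
have qge x m : (forall r, Q x r -> m <= r) -> m <= q x.
  by move=> h; apply: lb_le_inf => //; exact: Q0.
split=> //; split=> [x y|c x c0].
  rewrite -lerBlDr; refine (qge x _ _) => r Qr; rewrite lerBlDr -lerBlDl.
  refine (qge y _ _) => s Qs; rewrite lerBlDl.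
  have [t Qt] := QD _ _ _ _ Qr Qs; apply: le_trans; exact: lbq.
rewrite mulrC -ler_pdivrMr //; refine (qge x _ _) => r Qr.
by rewrite ler_pdivrMr // mulrC; apply: lbq; exact: QZ.
Qed.

(** Zorn's lemma; [- p (- x)] bounds every sublinear minorant of [p] from below, so infima of chains
    stay finite. *)
Lemma sublinear_minimal p : sublinear p ->
  exists q, [/\ sublinear q, forall x, q x <= p x &
    forall q', sublinear q' -> (forall x, q' x <= q x) -> q' = q].
Proof.
move=> sp.
pose T := {q : E -> R | sublinear q /\ forall x, q x <= p x}.
(* The order is reversed, so that a maximal element is a minimal functional. *)
pose le (s t : T) := `[< forall x, sval t x <= sval s x >].
have Tge (t : T) x : - p (- x) <= sval t x.
  case: t => q [sq qp] /=; apply: le_trans _ (sublinear_ge q x sq).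
  by rewrite lerN2.
have [|||C totC|[q [sq qp]] minq] := @Zorn T (fun s t => le s t).
- by move=> t; apply/asboolP.
- move=> r s t /asboolP rs /asboolP st; apply/asboolP => x.
  exact: le_trans (st x) (rs x).
- move=> [s Ps] [t Pt] /asboolP /= st /asboolP /= ts; apply: eq_exist => /=.
  by apply/funext => x; apply/le_anti; rewrite st ts.
- have [->|/set0P[t0 Ct0]] := eqVneq C set0.
    have pp : sublinear p /\ forall x, p x <= p x by split.
    by exists (exist _ p pp).
  pose Q x r := exists2 t, C t & r = sval t x.
  have [|||c x r c0 [t Ct ->]|sq lbq] := @inf_sublinear Q.
  + by move=> x; exists (sval t0 x), t0.
  + by move=> x; exists (- p (- x)) => r [t _ ->].
  + move=> x y r s [t Ct ->] [u Cu ->].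
    have [/asboolP tu|/asboolP ut] := totC _ _ Ct Cu.
      exists (sval u (x + y)); first by exists u.
      by apply: le_trans ((svalP u).1.1 x y) _; rewrite lerD2r.
    exists (sval t (x + y)); first by exists t.
    by apply: le_trans ((svalP t).1.1 x y) _; rewrite lerD2l.
  + exists t => //; apply/le_anti; rewrite (svalP t).1.2 // andbT.
    have := (svalP t).1.2 c^-1 (c *: x); rewrite invr_gt0 scalerA mulVf ?gt_eqF //.
    by rewrite scale1r ler_pdivlMl //; apply.
  have qp x : inf [set r | Q x r] <= p x.
    apply: le_trans ((svalP t0).2 x); apply: lbq; by exists t0.
  exists (exist _ _ (conj sq qp) : T) => s Cs; apply/asboolP => x /=.
  by apply: lbq; exists s.
exists q; split => // q' sq' q'q.
have q'p x : q' x <= p x by exact: le_trans (qp x).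
have := minq (exist _ q' (conj sq' q'p) : T).
have -> : le (exist _ q (conj sq qp) : T) (exist _ q' (conj sq' q'p) : T)
  by apply/asboolP.
by move=> /(_ isT) [].
Qed.

(* Minimal sublinear functionals are linear: compare [q] with
   [x |-> inf_(t >= 0) (q (x + t y) - t q y)]. *)
Lemma sublinear_minorant p : sublinear p ->
  exists2 f, linear_form f & forall x, f x <= p x.
Proof.
move=> /sublinear_minimal[q [sq qp minq]]; exists q => //.
have qZ c x : 0 < c -> q (c *: x) = c * q x.
  move=> c0; apply/le_anti; rewrite sq.2 //=.
  have := sq.2 c^-1 (c *: x); rewrite invr_gt0 scalerA mulVf ?gt_eqF //.
  by rewrite scale1r ler_pdivlMl //; apply.
have qD x y : q (x + y) = q x + q y.
  apply/le_anti; rewrite sq.1 /=.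
  pose Q x r := exists2 t, 0 <= t & r = q (x + t *: y) - t * q y.
  have [|x'||c x' r c0 [t t0 ->]|sq' lbq] := @inf_sublinear Q.
  - by move=> x'; exists (q (x' + 0 *: y) - 0 * q y), 0.
  - exists (- q (- x')) => r [t t0 ->].
    have tq : q (t *: y) = t * q y.
      move: t0; rewrite le_eqVlt => /orP[/eqP<-|/qZ//].
      by rewrite scale0r mul0r sublinear0.
    rewrite -tq; have := sq.1 (x' + t *: y) (- x').
    by rewrite addrAC subrr add0r; lra.
  - move=> x1 x2 r s [t t0 ->] [u u0 ->].
    exists (q (x1 + x2 + (t + u) *: y) - (t + u) * q y).
      by exists (t + u) => //; rewrite addr_ge0.
    have := sq.1 (x1 + t *: y) (x2 + u *: y).
    by rewrite addrACA -scalerDl; lra.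
  - exists (c * t); first by rewrite mulr_ge0 // ltW.
    by rewrite -scalerA -scalerDr qZ //; ring.
  have inf_le x' : inf [set r | Q x' r] <= q x'.
    by apply: lbq; exists 0 => //; rewrite scale0r mul0r addr0 subr0.
  have infE : inf [set r | Q x r] = q x := congr1 (fun f => f x) (minq _ sq' inf_le).
  (* The value [t = 1] in the infimum gives [q x <= q (x + y) - q y]. *)
  rewrite -lerBrDr -infE; apply: lbq; exists 1 => //.
  by rewrite scale1r mul1r.
have q0 := sublinear0 q sq.
have qN x : q (- x) = - q x.
  by have := qD x (- x); rewrite subrr q0; lra.
move=> a x y; rewrite qD; congr (_ + _).
have [a0|a0|->] := ltgtP a 0; last by rewrite scale0r mul0r q0.
  by have := qZ (- a) x; rewrite oppr_gt0 scaleNr qN => /(_ a0); lra.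
exact: qZ.
Qed.

(** A linear minorant of the infimum of [N x] and all [N (x - l a) + l s] with [A a s] lies below
    [N], and below [r] at [x] whenever [A x r] (take [l = 1], [a = x]). *)
Lemma hahn_banach_sandwich N (A : E -> R -> Prop) :
  (forall x y, N (x + y) <= N x + N y) ->
  (forall a x, N (a *: x) = `|a| * N x) ->
  convex_rel A -> (forall x r, A x r -> 0 <= r + N x) ->
  exists f, [/\ linear_form f, forall x, `|f x| <= N x &
    forall x r, A x r -> f x <= r].
Proof.
move=> ND NZ cA AN.
have NN x : N (- x) = N x by rewrite -scaleN1r NZ normrN1 mul1r.
have N0 : N 0 = 0 by rewrite -(scale0r 0) NZ normr0 mul0r.
pose Q x r := r = N x \/
  exists l a s, [/\ 0 < l, A a s & r = N (x - l *: a) + l * s].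
have [|x|||sq lbq] := @inf_sublinear Q.
- by move=> x; exists (N x); left.
- exists (- N x) => r [->|[l [a [s [l0 /AN As ->]]]]].
    by have := ND x (- x); rewrite subrr N0 NN; lra.
  have := ND (x - l *: a) (- x); rewrite addrAC subrr add0r !NN NZ gtr0_norm //.
  have := mulr_ge0 (ltW l0) As; lra.
- move=> x y r s [->|[l [a [u [l0 Aa ->]]]]] [->|[m [b [v [m0 Ab ->]]]]].
  + by exists (N (x + y)) => //; left.
  + exists (N (x + y - m *: b) + m * v); first by right; exists m, b, v.
    by have := ND x (y - m *: b); rewrite addrA; lra.
  + exists (N (x + y - l *: a) + l * u); first by right; exists l, a, u.
    by have := ND (x - l *: a) y; rewrite addrAC; lra.
  + have lm0 : 0 < l + m by rewrite addr_gt0.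
    have lmu : l + m != 0 by rewrite gt_eqF.
    have Ac := cA (l / (l + m)) _ _ _ _ _ Aa Ab.
    have e1 : 1 - l / (l + m) = m / (l + m) by field.
    rewrite e1 in Ac; have {Ac} := Ac _.
    have -> : 0 <= l / (l + m) <= 1.
      by rewrite divr_ge0 ?(ltW l0) ?(ltW lm0) // ler_pdivrMr // mul1r lerDl ltW.
    move=> /(_ isT) Ac.
    exists (N (x + y - (l *: a + m *: b)) + (l * u + m * v)).
      right; exists (l + m), (l / (l + m) *: a + m / (l + m) *: b),
        (l / (l + m) * u + m / (l + m) * v).
      split=> //; rewrite scalerDr !scalerA.
      have -> : (l + m) * (l / (l + m)) = l by field.
      have -> : (l + m) * (m / (l + m)) = m by field.
      by congr (_ + _); field.
    by have := ND (x - l *: a) (y - m *: b); rewrite addrACA -opprD; lra.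
- move=> c x r c0 [->|[l [a [s [l0 Aa ->]]]]].
    by left; rewrite NZ gtr0_norm.
  right; exists (c * l), a, s; rewrite mulr_gt0 //; split => //.
  by rewrite -scalerA -scalerBr NZ gtr0_norm // mulrDr mulrA.
have [f lf fq] := sublinear_minorant _ sq.
have fN x : f x <= N x by apply: le_trans (fq x) _; apply: lbq; left.
exists f; split => // [x|x r Ax].
  rewrite ler_norml fN andbT.
  by have := fN (- x); rewrite NN linear_formN //; lra.
apply: le_trans (fq x) _; apply: lbq; right; exists 1, x, r.
by rewrite scale1r subrr N0 mul1r add0r.
Qed.

End HahnBanach.

(** * Nested balls and uniform boundedness on a closed subspace *)

Section NestedBalls.
Context {R : realType} {X : completeNormedModType R}.

Lemma nested_balls (V : set X) (x : nat -> X) (r : nat -> R) :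
  closed V -> (forall n, V (x n)) ->
  (forall n, 0 < r n) -> (forall n, r n.+1 <= r n / 2) ->
  (forall n, `|x n.+1 - x n| + r n.+1 <= r n) ->
  exists2 y, V y & forall n, `|y - x n| <= r n.
Proof.
move=> cV Vx r0 rle xr.
have xle n k : `|x (n + k)%N - x n| + r (n + k)%N <= r n.
  elim: k => [|k IH]; first by rewrite addn0 subrr normr0 add0r.
  rewrite addnS; have := xr (n + k)%N.
  have := ler_distD (x (n + k)%N) (x (n + k).+1) (x n); lra.
have xle' n m : (n <= m)%N -> `|x n - x m| <= r n.
  move=> /subnKC <-; rewrite distrC.
  have := xle n (m - n)%N; have := r0 (n + (m - n))%N; lra.
have rgeo n : r n <= r 0%N / 2 ^+ n.
  elim: n => [|n IH]; first by rewrite expr0 divr1.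
  by rewrite exprS invfM; have := rle n; lra.
have : cvg (x @ \oo).
  apply: cauchy_cvg; apply: cauchy_exP => e e0.
  have [n nlt] : exists n, r n < e.
    exists (Num.truncn (r 0%N / e)).+1; apply: (le_lt_trans (rgeo _)).
    rewrite ltr_pdivrMr ?exprn_gt0 // mulrC -ltr_pdivrMr //.
    apply: lt_le_trans (truncnS_gt _) _.
    by rewrite -natrX ler_nat ltnW // ltn_expl.
  exists (x n), n => // m /= nm; rewrite -ball_normE /=.
  exact: le_lt_trans (xle' _ _ nm) _.
move=> /cvg_ex[y xy]; exists y.
  by apply: (@closed_cvg _ _ \oo _ x) xy => //; apply: nearW.
move=> n; have : closed_ball (x n) (r n) y.
  apply: (@closed_cvg _ _ \oo _ x) xy => //; first exact: closed_ball_closed.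
  by exists n => // m /= nm; rewrite closed_ballE //; exact: xle'.
by rewrite closed_ballE // /closed_ball_ /= distrC.
Qed.

(** If no uniform bound exists, every ball centred in [V] contains a smaller one, also centred in
    [V], on which some [f n] is large; a point common to such a sequence of balls contradicts the
    pointwise bound. *)
Lemma uniform_boundedness (V : set X) (f : nat -> X -> R) :
  closed V -> lin_subspace V -> (forall n, linear_form (f n)) ->
  (forall n, exists2 K, 0 <= K & forall x, `|f n x| <= K * `|x|) ->
  (forall x, V x -> exists M, forall n, `|f n x| <= M) ->
  exists2 C, 0 <= C & forall n x, V x -> `|f n x| <= C * `|x|.
Proof.
move=> cV [V0 Vlin] lf fK fM; apply: contrapT => unb.
have VZ a x : V x -> V (a *: x).
  by move=> Vx; rewrite -[_ *: _]addr0; exact: Vlin.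
pose T := {s : X * R | V s.1 /\ 0 < s.2}.
pose P (ms : nat * T) (s' : T) :=
  [/\ (sval s').2 <= (sval ms.2).2 / 2,
      `|(sval s').1 - (sval ms.2).1| + (sval s').2 <= (sval ms.2).2 &
      exists n, forall z, `|z - (sval s').1| <= (sval s').2 -> ms.1%:R <= `|f n z|].
have stepP ms : exists s', P ms s'.
  case: ms => m [[x r] [/= Vx r0]].
  have [n [u [Vu fu]]] : exists n u, V u /\ m.+1%:R * 2 / r * `|u| < `|f n u|.
    apply: contrapT => h; apply: unb; exists (m.+1%:R * 2 / r).
      by rewrite divr_ge0 ?mulr_ge0 // ltW.
    move=> n u Vu; rewrite leNgt; apply/negP => fu; apply: h.
    by exists n, u.
  have u0 : 0 < `|u|.
    rewrite normr_gt0; apply/eqP => u0.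
    by move: fu; rewrite u0 (linear_form0 (lf n)) !normr0 mulr0 ltxx.
  pose y := (r / 2 / `|u|) *: u.
  have Vy : V y by exact: VZ.
  have ny : `|y| = r / 2.
    rewrite normrZ gtr0_norm; last by rewrite !divr_gt0.
    by rewrite divfK // gt_eqF.
  have fy : m.+1%:R <= `|f n y|.
    rewrite (linear_formZ (lf n)) normrM gtr0_norm; last by rewrite !divr_gt0.
    apply: ltW; have h0 : 0 < r / 2 / `|u| by rewrite !divr_gt0.
    move: fu; rewrite -(ltr_pM2l h0); apply: le_lt_trans.
    rewrite le_eqVlt; apply/orP; left; apply/eqP; field.
    by rewrite !gt_eqF.
  (* Since [f n (x + y)] and [f n (x - y)] differ by [2 f n y], they cannot both be smaller than
     [m + 1] in absolute value. *)
  have [x' [Vx' xx' fx']] : exists x',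
      [/\ V x', `|x' - x| = r / 2 & m.+1%:R <= `|f n x'|].
    have [h|h] := leP m.+1%:R `|f n (x + y)|.
      exists (x + y); split => //; last by rewrite addrAC subrr add0r.
      by have := Vlin 1 x y Vx Vy; rewrite scale1r.
    exists (x - y); split.
    - by have := Vlin (-1) y x Vy Vx; rewrite scaleN1r addrC.
    - by rewrite addrAC subrr add0r normrN.
    - move: h; rewrite (linear_formD (lf n)) (linear_formB (lf n)).
      have := ler_normB (f n x + f n y) (f n x - f n y).
      have -> : f n x + f n y - (f n x - f n y) = 2 * f n y by ring.
      by rewrite normrM gtr0_norm //; lra.
  have [K K0 fnK] := fK n.
  have K1 : 0 < K + 1 by lra.
  (* On a ball of this radius [f n] varies by at most 1, so the bound [m + 1] at the centre leaves
     [m] throughout. *)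
  pose r' := Num.min (r / 2) (K + 1)^-1.
  have r'0 : 0 < r' by rewrite lt_min divr_gt0 // invr_gt0.
  have r'r : r' <= r / 2 by rewrite ge_min lexx.
  have r'K : K * r' <= 1.
    have h : r' <= (K + 1)^-1 by rewrite ge_min lexx orbT.
    have : (K + 1) * r' <= 1 by rewrite -ler_pdivlMl // mulr1.
    by rewrite mulrDl mul1r; lra.
  exists (exist _ (x', r') (conj Vx' r'0) : T); split => //=; first by rewrite xx'; lra.
  exists n => z zx'.
  have := fnK (z - x'); have := ler_wpM2l K0 zx'.
  have := ler_normD (f n z) (- (f n (z - x'))); rewrite normrN.
  have -> : f n z - f n (z - x') = f n x' by rewrite (linear_formB (lf n)); ring.
  by move: fx'; rewrite -natr1; lra.
have [g gP] := choice stepP.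
pose s := fix s k := if k is k'.+1 then g (k', s k')
  else exist _ (0, 1) (conj V0 ltr01) : T.
have sP k : P (k, s k) (s k.+1) by exact: gP.
have [|k|k|k|k|y Vy ys] := nested_balls V
  (fun k => (sval (s k)).1) (fun k => (sval (s k)).2).
- by [].
- exact: (svalP (s k)).1.
- exact: (svalP (s k)).2.
- by have [] := sP k.
- by have [] := sP k.
have [M fyM] := fM _ Vy.
have [_ _ [n fn]] := sP (Num.truncn M).+1.
have := fn y (ys _); have := fyM n; have := truncnS_gt M; rewrite /=; lra.
Qed.

End NestedBalls.

(** * Sandwich theorem on the product of [X] with the real line *)

Definition bounded_by {R : realType} {X : normedModType R} (f : X -> R) (K : R) :=
  forall x, `|f x| <= K * `|x|.

Lemma bounded_byW {R : realType} {X : normedModType R} (f : X -> R) (K K' : R) :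
  K <= K' -> bounded_by f K -> bounded_by f K'.
Proof. by move=> KK' fK x; apply: le_trans (fK x) _; exact: ler_wpM2r. Qed.

Lemma hahn_banach_sandwich_prod {R : realType} {X : normedModType R}
    (A : X -> R -> R -> Prop) (K : R) : 0 <= K ->
  (forall l u u' b b' v v', 0 <= l <= 1 -> A u b v -> A u' b' v' ->
    A (l *: u + (1 - l) *: u') (l * b + (1 - l) * b') (l * v + (1 - l) * v')) ->
  (forall u b v, A u b v -> 0 <= v + K * `|u| + K * `|b|) ->
  exists g s, [/\ linear_form g, bounded_by g K, `|s| <= K &
    forall u b v, A u b v -> g u + s * b <= v].
Proof.
move=> K0 cA Age.
pose N (p : X * R^o) := K * `|p.1| + K * `|p.2 : R|.
have [|a p|l p p' v v' l01|p v|F [lF FN FA]] :=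
    hahn_banach_sandwich N (fun p v => A p.1 p.2 v).
- move=> p q; rewrite /N /=.
  have := ler_wpM2l K0 (ler_normD p.1 q.1).
  by have := ler_wpM2l K0 (ler_normD (p.2 : R) q.2); lra.
- by rewrite /N /= normrZ normrM; ring.
- exact: cA.
- by move=> /Age; rewrite /N addrA.
have Fpair x (b : R) : F (x, b) = F (x, 0) + F (0, 1) * b.
  have -> : ((x, b) : X * R^o) = b *: ((0, 1) : X * R^o) + (x, 0).
    congr pair; rewrite /= ?scaler0 ?add0r //.
    by rewrite addr0 /GRing.scale /= mulr1.
  by rewrite lF; ring.
exists (fun x => F (x, 0)), (F (0, 1)); split.
- move=> a x y; rewrite -lF; congr F; congr pair; rewrite /= addr0.
  by rewrite /GRing.scale /= mulr0.
- by move=> x; have := FN (x, 0); rewrite /N /= normr0 mulr0 addr0.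
- by have := FN (0, 1); rewrite /N /= normr0 normr1 mulr0 add0r mulr1.
- by move=> u b v Av; have := FA (u, b) v Av; rewrite Fpair.
Qed.

(** * Duality along a line, solved by truncation *)

Section Existence.
Context {R : realType} {X : completeNormedModType R}.
(** [B] stands for the epigraph of a convex function of [(w, f)] that dominates [f w]; [Bcore] puts
    [y] in the core, relative to [V], of its projection to [X]. *)
Variables (V : set X) (B : X -> (X -> R) -> R -> Prop) (y d : X).
Hypotheses (cV : closed V) (sV : lin_subspace V).
Hypothesis cB : forall l w w' f f' r r', 0 <= l <= 1 -> B w f r -> B w' f' r' ->
  B (l *: w + (1 - l) *: w') (fun x => l * f x + (1 - l) * f' x)
    (l * r + (1 - l) * r').
Hypothesis Blin : forall w f r, B w f r -> linear_form f.
Hypothesis Bbdd : forall w f r, B w f r -> exists K, bounded_by f K.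
Hypothesis Bge : forall w f r, B w f r -> f w <= r.
Hypothesis BV : forall w f r, B w f r -> V w.
Hypothesis Vd : V d.
Hypothesis Bcore : forall u, V u -> exists t f r, 0 < t /\ B (y + t *: u) f r.

(* The truncation at [n] gives [A_ge]: [v >= f u + t b + (t - 1 - c)^2 / 2]. *)
Let A (n : nat) (u : X) (b v : R) := exists w f r t c,
  [/\ B w f r, bounded_by f n%:R, `|t| <= n%:R,
      u = w - y - t *: d /\ b = f d + c &
      r - f y + (t - 1) ^+ 2 / 2 + c ^+ 2 / 2 + c <= v].

Let A_mono n m u b v : (n <= m)%N -> A n u b v -> A m u b v.
Proof.
move=> nm [w [f [r [t [c [Bw fn tn e ve]]]]]].
exists w, f, r, t, c; split=> //.
  by apply: bounded_byW fn; rewrite ler_nat.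
by apply: le_trans tn _; rewrite ler_nat.
Qed.

(** The conjugate of [(t - 1) ^+ 2 / 2] at [c] is [c ^+ 2 / 2 + c], so this is the Fenchel-Young
    inequality added to [f w <= r]. Here [u] and [b] measure the failure of [w = y + t d] and
    [c = - f d]. *)
Let A_ge n u b v : A n u b v -> 0 <= v + n%:R * `|u| + n%:R * `|b|.
Proof.
move=> [w [f [r [t [c [Bw fn tn [uE bE] ve]]]]]].
have lf := Blin _ _ _ Bw; have rw := Bge _ _ _ Bw.
have fu : f w = f u + f y + t * f d.
  by rewrite uE !(linear_formB lf) (linear_formZ lf); ring.
have := fn u; rewrite ler_norml => /andP[fu1 _].
have tb : - (n%:R * `|b|) <= t * b.
  have : `|t * b| <= n%:R * `|b| by rewrite normrM ler_wpM2r.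
  by rewrite ler_norml => /andP[].
have sq := sqr_ge0 (t - 1 - c).
have : v - f u - t * b >= (t - 1 - c) ^+ 2 / 2.
  apply: le_trans
    (_ : r - f y + (t - 1) ^+ 2 / 2 + c ^+ 2 / 2 + c - f u - t * b <= _); last first.
    by rewrite !lerD2r.
  rewrite -subr_ge0.
  have -> : r - f y + (t - 1) ^+ 2 / 2 + c ^+ 2 / 2 + c - f u - t * b -
    (t - 1 - c) ^+ 2 / 2 = r - f w by rewrite fu bE; field.
  by rewrite subr_ge0.
lra.
Qed.

Let A_convex n l u u' b b' v v' : 0 <= l <= 1 -> A n u b v -> A n u' b' v' ->
  A n (l *: u + (1 - l) *: u') (l * b + (1 - l) * b') (l * v + (1 - l) * v').
Proof.
move=> l01 [w [f [r [t [c [Bw fn tn [-> ->] ve]]]]]].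
move=> [w' [f' [r' [t' [c' [Bw' fn' tn' [-> ->] ve']]]]]].
have /andP[l0 l1] := l01; have m0 : 0 <= 1 - l by rewrite subr_ge0.
have cvx (p q M : R) : `|p| <= M -> `|q| <= M -> `|l * p + (1 - l) * q| <= M.
  move=> pM qM; apply: le_trans (ler_normD _ _) _.
  rewrite !normrM (ger0_norm l0) (ger0_norm m0).
  by have := ler_wpM2l l0 pM; have := ler_wpM2l m0 qM; lra.
exists (l *: w + (1 - l) *: w'), (fun x => l * f x + (1 - l) * f' x).
exists (l * r + (1 - l) * r'), (l * t + (1 - l) * t'), (l * c + (1 - l) * c').
split.
- exact: cB.
- by move=> x; exact: cvx.
- exact: cvx.
- split; last by ring.
  have yE : y = l *: y + (1 - l) *: y by rewrite -scalerDl addrC subrK scale1r.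
  move: (1 - l) yE => m yE.
  rewrite !scalerBr [in RHS]scalerDl -!scalerA [in RHS]yE.
  by rewrite addrACA (addrACA (l *: w)) -!opprD.
- have h1 := ler_wpM2l l0 ve; have h2 := ler_wpM2l m0 ve'.
  apply: le_trans (lerD h1 h2); rewrite -subr_ge0.
  set D := (X in 0 <= X).
  have -> : D = l * (1 - l) / 2 * ((t - t') ^+ 2 + (c - c') ^+ 2) by rewrite /D; field.
  apply: mulr_ge0; first by apply: divr_ge0 => //; exact: mulr_ge0.
  by apply: addr_ge0; exact: sqr_ge0.
Qed.

Lemma exists_saddle : exists g s, [/\ linear_form g, exists K, bounded_by g K &
  forall w f r t, B w f r ->
    g w + f (y + s *: d) <=
    r + g (y + t *: d) + (t - 1) ^+ 2 / 2 - (s - 1) ^+ 2 / 2].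
Proof.
have V0 := sV.1.
have VN u : V u -> V (- u).
  by move=> Vu; have := sV.2 (-1) u 0 Vu V0; rewrite scaleN1r addr0.
have gs_ex n : exists gs : (X -> R) * R,
    [/\ linear_form gs.1, bounded_by gs.1 n%:R, `|gs.2| <= n%:R &
      forall u b v, A n u b v -> gs.1 u + gs.2 * b <= v].
  have [g [s gsP]] := hahn_banach_sandwich_prod (A n) n%:R (ler0n _ n)
    (A_convex n) (A_ge n).
  by exists (g, s).
have [gs gsP] := choice gs_ex.
(* With [t = 0], the free variable [c] reaches every [b], and the resulting [v] is the same for all
   large truncation levels. *)
have AV u : V u -> exists t n, 0 < t /\
    forall b, exists v, forall m, (n <= m)%N -> A m (t *: u) b v.
  move=> /Bcore[t [f [r [t0 Bf]]]]; have [K fK] := Bbdd _ _ _ Bf.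
  exists t, (Num.truncn K).+1; split=> // b; eexists => m nm.
  apply: A_mono nm _.
  exists (y + t *: u), f, r, 0, (b - f d); split=> //.
  - by apply: bounded_byW fK; exact/ltW/truncnS_gt.
  - by rewrite normr0.
  - split; last by ring.
    by rewrite scale0r subr0 addrAC subrr add0r.
(* Levels from [n] on are bounded through the admissible point, the finitely many others through
   their norm bound. *)
have ubd u b : V u -> exists M, forall n, (gs n).1 u + (gs n).2 * b <= M.
  move=> Vu; have [t [n [t0 /(_ (t * b))[v Av]]]] := AV u Vu.
  exists (`|v| / t + n%:R * `|u| + n%:R * `|b|) => m.
  have [lg gK sK gA] := gsP m; have [nm|mn] := leqP n m.
    have := gA _ _ _ (Av m nm); rewrite (linear_formZ lg) => h.
    have : (gs m).1 u + (gs m).2 * b <= `|v| / t.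
      by rewrite ler_pdivlMr //; have := ler_norm v; lra.
    have : 0 <= n%:R * `|u| + n%:R * `|b| by rewrite addr_ge0 // mulr_ge0.
    lra.
  have mn' : m%:R <= n%:R :> R by rewrite ler_nat ltnW.
  have := le_trans (ler_norm _) (bounded_byW _ _ _ mn' gK u).
  have sb : (gs m).2 * b <= n%:R * `|b|.
    apply: le_trans (ler_norm _) _; rewrite normrM ler_wpM2r //.
    exact: le_trans mn'.
  have : 0 <= `|v| / t by rewrite divr_ge0 // ltW.
  lra.
have [M sM] : exists M, forall n, `|(gs n).2| <= M.
  have [M1 h1] := ubd 0 1 V0; have [M2 h2] := ubd 0 (-1) V0.
  exists (`|M1| + `|M2|) => n; have [lg _ _ _] := gsP n.
  have := h1 n; have := h2 n; rewrite (linear_form0 lg) !add0r.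
  have := ler_norm M1; have := ler_norm M2.
  have := normr_ge0 M1; have := normr_ge0 M2.
  by rewrite ler_norml; move=> *; apply/andP; split; lra.
have M0 : 0 <= M by apply: le_trans (sM 0%N).
have [|||C C0 gC] := uniform_boundedness V (fun n => (gs n).1) cV sV.
- by move=> n; have [] := gsP n.
- by move=> n; have [_ gK _ _] := gsP n; exists n%:R.
- move=> u Vu; have [M1 h1] := ubd u 0 Vu; have [M2 h2] := ubd (- u) 0 (VN u Vu).
  exists (`|M1| + `|M2|) => n; have [lg _ _ _] := gsP n.
  have := h1 n; have := h2 n; rewrite (linear_formN lg) mulr0 !addr0.
  have := ler_norm M1; have := ler_norm M2.
  have := normr_ge0 M1; have := normr_ge0 M2.
  by rewrite ler_norml; move=> *; apply/andP; split; lra.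
(* No limit of the [gs n] is taken: their common bounds [C] on [V] and [M] show that the union over
   all levels satisfies the sandwich hypothesis. *)
pose A' u b v := exists n, A n u b v.
have [||u b v|g [s [lg gK sK gA]]] := hahn_banach_sandwich_prod A' (C + M).
- exact: addr_ge0.
- move=> l u u' b b' v v' l01 [n An] [m Am]; exists (maxn n m).
  apply: A_convex => //; first exact: A_mono (leq_maxl _ _) An.
  exact: A_mono (leq_maxr _ _) Am.
- move=> [n An]; have [lg _ _ gA] := gsP n.
  have Vu : V u.
    have [w [f [r [t [c [Bw _ _ [-> _] _]]]]]] := An.
    have Vy : V y.
      by have [t' [f' [r' [_ /BV]]]] := Bcore _ V0; rewrite scaler0 addr0.
    rewrite -[t *: d]opprK addrC opprK -scaleNr.
    apply: sV.2 => //; rewrite addrC -scaleN1r.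
    by apply: sV.2 => //; exact: BV Bw.
  have := gA _ _ _ An; have := gC n u Vu; rewrite ler_norml => /andP[h1 _].
  have : - (M * `|b|) <= (gs n).2 * b.
    have : `|(gs n).2 * b| <= M * `|b| by rewrite normrM ler_wpM2r.
    by rewrite ler_norml => /andP[].
  have : 0 <= M * `|u| by exact: mulr_ge0.
  have : 0 <= C * `|b| by exact: mulr_ge0.
  lra.
exists g, s; split=> //; first by exists (C + M).
move=> w f r t Bw; have [K fK] := Bbdd _ _ _ Bw; have lf := Blin _ _ _ Bw.
(* The choice [c = s - 1] minimises [c ^+ 2 / 2 + c - s c], which produces the term
   [- (s - 1) ^+ 2 / 2]. *)
have Aw : A' (w - y - t *: d) (f d + (s - 1))
    (r - f y + (t - 1) ^+ 2 / 2 + (s - 1) ^+ 2 / 2 + (s - 1)).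
  exists (Num.truncn (Num.max K `|t|)).+1.
  have Kt := ltW (truncnS_gt (Num.max K `|t|)).
  exists w, f, r, t, (s - 1); split=> //.
    by apply: bounded_byW fK; apply: le_trans Kt; rewrite le_max lexx.
  by apply: le_trans Kt; rewrite le_max lexx orbT.
have := gA _ _ _ Aw.
rewrite !(linear_formB lg) (linear_formD lg) (linear_formD lf).
rewrite !(linear_formZ lg) !(linear_formZ lf).
lra.
Qed.

End Existence.

(** * Continuous functionals and annihilators *)

Section Dual.
Context {R : realType} {X : normedModType R}.
Implicit Types (p q : dual X).

Lemma dual_linear_form p : linear_form p.
Proof. exact: dual_linear. Qed.

Lemma dual_bounded p : exists2 K, 0 <= K & bounded_by p K.
Proof.
have lp := dual_linear_form p.
have /cvgrPdist_lt/(_ 1 ltr01)/nbhs_norm0P[e /= e0 pe] := @dual_cont _ _ p 0.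
exists (2 / e) => [|x]; first by rewrite divr_ge0 // ltW.
have [->|x0] := eqVneq x 0; first by rewrite (linear_form0 lp) !normr0 mulr0.
have nx : 0 < `|x| by rewrite normr_gt0.
have c0 : 0 < e / 2 / `|x| by rewrite !divr_gt0.
have := pe ((e / 2 / `|x|) *: x).
rewrite /= normrZ gtr0_norm // divfK ?gt_eqF // (linear_form0 lp) sub0r normrN.
rewrite (linear_formZ lp) normrM gtr0_norm // => /(_ _)/ltW h.
have {}h : e / 2 / `|x| * `|p x| <= 1 by apply: h; rewrite /=; lra.
have : (2 / e * `|x|) * (e / 2 / `|x| * `|p x|) <= 2 / e * `|x| * 1.
  by rewrite ler_wpM2l // mulr_ge0 // divr_ge0 // ltW.
rewrite mulr1; congr (_ <= _); field.
by rewrite !gt_eqF.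
Qed.

Lemma exists_dual (g : X -> R) (K : R) : linear_form g -> bounded_by g K ->
  exists p, forall x, p x = g x.
Proof.
move=> lg gK.
suff cg : continuous g by exists (@Dual _ _ g lg cg).
have K0 : 0 < `|K| + 1 by rewrite ltr_wpDl.
move=> x; apply/cvgrPdist_lt => e e0.
near=> z; rewrite -(linear_formB lg); apply: le_lt_trans (gK _) _.
apply: (@le_lt_trans _ _ ((`|K| + 1) * `|x - z|)).
  by rewrite ler_wpM2r //; have := ler_norm K; lra.
rewrite mulrC -ltr_pdivlMr //; near: z.
by apply: cvgr_dist_lt => //; rewrite divr_gt0.
Unshelve. all: by end_near. Qed.

(** The record [dual] has no vector space structure here, so combinations are described by their
    values. *)
Lemma exists_dual_comb (a b : R) p q :
  exists r : dual X, forall x, r x = a * p x + b * q x.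
Proof.
have [K K0 pK] := dual_bounded p; have [L L0 qL] := dual_bounded q.
apply: (@exists_dual _ (`|a| * K + `|b| * L)) => [c x y|x].
  by rewrite !dual_linear; ring.
apply: le_trans (ler_normD _ _) _; rewrite !normrM mulrDl -!mulrA.
by apply: lerD; rewrite ler_wpM2l.
Qed.

Lemma ddist_bounded p q (e : R) : (ddist p q < e%:E)%E ->
  bounded_by (fun x => p x - q x) e.
Proof.
move=> pq x; have [lp lq] := (dual_linear_form p, dual_linear_form q).
have [->|x0] := eqVneq x 0.
  by rewrite (linear_form0 lp) (linear_form0 lq) subrr !normr0 mulr0.
have nx : 0 < `|x| by rewrite normr_gt0.
have : (`|p (`|x|^-1 *: x) - q (`|x|^-1 *: x)|%:E <= ddist p q)%E.
  apply: ereal_sup_ubound; exists (`|x|^-1 *: x) => //=.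
  by rewrite normrZ normfV normr_id mulVf // gt_eqF.
move=> /le_lt_trans/(_ pq); rewrite lte_fin => /ltW.
rewrite (linear_formZ lp) (linear_formZ lq) -mulrBr normrM normfV normr_id.
by rewrite ler_pdivrMl // mulrC.
Qed.

(** Sandwich theorem for the norm divided by a lower bound [e] of the distance from [z] to [V], and
    the linear map sending [x + r z] to [r]. *)
Lemma exists_annihilator (V : set X) (z : X) :
  closed V -> lin_subspace V -> ~ V z ->
  exists p, p z = 1 /\ forall x, V x -> p x = 0.
Proof.
move=> cV [V0 Vlin] nVz.
have [e e0 ze] : exists2 e, 0 < e & forall x, V x -> e <= `|z - x|.
  have : nbhs z (~` V) by apply: open_nbhs_nbhs; split => //; exact: closed_openC.
  move=> /nbhs_normP[e /= e0 eV]; exists e => // x Vx.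
  by rewrite leNgt; apply/negP => /eV.
have VZ a x : V x -> V (a *: x).
  by move=> Vx; rewrite -[_ *: _]addr0; exact: Vlin.
have [|||u r [x [Vx ->]]|f [lf fN fA]] := hahn_banach_sandwich
    (fun x => e^-1 * `|x|) (fun u r => exists x, V x /\ u = x + r *: z).
- by move=> x y; rewrite -mulrDr ler_wpM2l ?ler_normD ?invr_ge0 ?(ltW e0).
- by move=> a x; rewrite normrZ mulrCA.
- move=> l u v r s _ [x [Vx ->]] [y [Vy ->]].
  exists (l *: x + (1 - l) *: y); split; first by apply: Vlin => //; exact: VZ.
  by move: (1 - l) => m; rewrite !scalerDr scalerDl !scalerA addrACA.
- have [r0|r0] := leP 0 r; first by rewrite addr_ge0 ?mulr_ge0 ?invr_ge0 ?(ltW e0).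
  have -> : x + r *: z = r *: (z - (- r^-1) *: x).
    by rewrite scalerBr scalerA mulrN divff ?lt_eqF // scaleN1r opprK addrC.
  rewrite normrZ ltr0_norm //.
  have := ze _ (VZ (- r^-1) _ Vx); move: (`|_ - _|) => n en.
  have : 1 <= e^-1 * n by rewrite ler_pdivlMl // mulr1.
  have : 0 < - r by lra.
  move=> r0'; rewrite -(ler_pM2l r0'); lra.
have [p pf] := exists_dual f e^-1 lf fN.
exists p; split=> [|x Vx]; rewrite pf.
  have h1 : f z <= 1 by apply: fA; exists 0; rewrite add0r scale1r.
  have : f (- z) <= -1 by apply: fA; exists 0; rewrite add0r scaleN1r.
  by rewrite (linear_formN lf); lra.
have h1 : f x <= 0 by apply: fA; exists x; rewrite scale0r addr0.
have : f (- x) <= 0.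
  by apply: fA; exists (- x); rewrite scale0r addr0 -scaleN1r; split => //; exact: VZ.
by rewrite (linear_formN lf); lra.
Qed.

End Dual.

(** * Convexity and lower semicontinuity of the conjugate *)

Section Conjugate.
Context {R : realType} {X : normedModType R}.
Variable h : X * dual X -> \bar R.
Hypothesis h_ge : forall p : X * dual X, ((p.2 p.1)%:E <= h p)%E.

(** This removes extended-real subtraction: [h_ge] excludes the value [-oo], and points where [h] is
    [+oo] contribute [-oo] to the supremum. *)
Lemma Jconj_leP (p : X * dual X) (m : R) : (Jconj h p <= m%:E)%E <->
  forall q r, (h q <= r%:E)%E -> p.2 q.1 + q.2 p.1 - r <= m.
Proof.
split=> [hm q r hr|hm].
  rewrite -lee_fin; apply: le_trans hm.
  apply: le_trans (_ : ((p.2 q.1 + q.2 p.1)%:E - h q <= _)%E).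
    by rewrite EFinB leeB.
  by apply: ereal_sup_ubound; exists q.
apply: ge_ereal_sup => _ [q _ <-]; have := hm q; have := h_ge q.
case: (h q) => [r _ /(_ r (lexx _))| _ _|] //.
by rewrite addeNy leNye.
Qed.

Lemma Jconj_convex : convex_XX (Jconj h).
Proof.
move=> p q r l a b /andP[l0 l1] r1 r2 /Jconj_leP pa /Jconj_leP qb.
have m0 : 0 <= 1 - l by rewrite subr_ge0.
apply/Jconj_leP => s t /[dup] /pa h1 /qb h2.
have ls := dual_linear_form s.2.
rewrite r1 r2 (linear_formD ls) !(linear_formZ ls).
by have := ler_wpM2l l0 h1; have := ler_wpM2l m0 h2; lra.
Qed.

Lemma Jconj_lsc : lsc_XX (Jconj h).
Proof.
move=> p t /ereal_sup_gt[_ [q _ <-]].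
have := h_ge q; case hq : (h q) => [r| |] // _.
rewrite lte_fin => tr.
have [K K0 qK] := dual_bounded q.2; have [L L0 pL] := dual_bounded p.2.
set m := p.2 q.1 + q.2 p.1 - r in tr.
have N0 : 0 < `|q.1| + K + 1 by rewrite ltr_wpDl // addr_ge0.
(* Within radius [e] the affine function given by [q] drops by at most [e (|q.1| + K)]; the added 1
   makes the inequality strict. *)
exists ((m - t) / (`|q.1| + K + 1)); first by rewrite divr_gt0 // subr_gt0.
set e := _ / _ => p' dp /ddist_bounded/(_ q.1).
have eN : e * (`|q.1| + K + 1) = m - t by rewrite divfK // gt_eqF.
have e0 : 0 < e by rewrite divr_gt0 // subr_gt0.
rewrite ler_norml => /andP[d1 _].
have := qK (p'.1 - p.1); rewrite ler_norml (linear_formB (dual_linear_form q.2)).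
move=> /andP[d2 _].
have d3 : K * `|p'.1 - p.1| <= K * e by rewrite ler_wpM2l // ltW.
apply: (@lt_le_trans _ _ (p'.2 q.1 + q.2 p'.1 - r)%:E).
  by rewrite lte_fin; rewrite /m in eN; lra.
by apply: ereal_sup_ubound; exists q => //; rewrite hq.
Qed.

End Conjugate.

(** * Points of [T] and maximal monotonicity *)

Section Maximality.
Context {R : realType} {X : completeNormedModType R}.
Variable h : X * dual X -> \bar R.
Hypothesis h_convex : convex_XX h.
Hypothesis h_ge : forall p : X * dual X, ((p.2 p.1)%:E <= h p)%E.
Hypothesis Jh_ge : forall p : X * dual X, ((p.2 p.1)%:E <= Jconj h p)%E.
Hypothesis V_closed : closed (cone_PrX h).
Hypothesis V_subspace : lin_subspace (cone_PrX h).

Let V := cone_PrX h.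
Let T := [set p : X * dual X | Jconj h p = (p.2 p.1)%:E].

Let in_T p : (Jconj h p <= (p.2 p.1)%:E)%E -> T p.
Proof. by move=> le; apply/le_anti; rewrite le Jh_ge. Qed.

Lemma PrXP x : PrX h x <-> exists p r, (h (x, p) <= r%:E)%E.
Proof.
split=> [[p]|[p [r hr]]]; last first.
  by exists p; rewrite /effdom /=; apply: le_lt_trans hr _; exact: ltry.
rewrite /effdom /=; have := h_ge (x, p); case hE : (h (x, p)) => [r| |] // _ _.
by exists p, r; rewrite hE.
Qed.

Lemma PrX_convex l x y : 0 <= l <= 1 -> PrX h x -> PrX h y ->
  PrX h (l *: x + (1 - l) *: y).
Proof.
move=> l01 /PrXP[p [r hp]] /PrXP[q [s hq]]; apply/PrXP.
have [c cE] := exists_dual_comb l (1 - l) p q.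
exists c, (l * r + (1 - l) * s).
exact: (h_convex (x, p) (y, q)) hp hq.
Qed.

Lemma PrX_sub_cone x : PrX h x -> V x.
Proof. by move=> Px; exists 1 => //; exists x => //; rewrite scale1r. Qed.

Lemma PrX_absorbing u : V u -> exists2 t, 0 < t & PrX h (t *: u).
Proof.
move=> [l l0 [y Py ->]]; exists l^-1; first by rewrite invr_gt0.
by rewrite scalerA mulVf ?scale1r // gt_eqF.
Qed.

Lemma PrX0 : PrX h 0.
Proof.
by have [t _] := PrX_absorbing 0 V_subspace.1; rewrite scaler0.
Qed.

(** Weight [l < 1] on [y] leaves weight [1 - l] for a small multiple of an arbitrary [u] in [V]. *)
Lemma PrX_core l y u : 0 <= l < 1 -> PrX h y -> V u ->
  exists2 t, 0 < t & PrX h (l *: y + t *: u).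
Proof.
move=> /andP[l0 l1] Py /PrX_absorbing[t t0 Pu].
exists ((1 - l) * t); first by rewrite mulr_gt0 // subr_gt0.
by rewrite -scalerA; apply: PrX_convex => //; rewrite l0 ltW.
Qed.

(* Here [z - p] is a subgradient, at [l y + s d], of the function equal to
   [(t - 1)^2 / 2] at [l y + t d] and to [+oo] off this line. *)
Lemma Jconj_saddle (z : dual X) (y d : X) (l : R) :
  PrX h y -> 0 <= l < 1 -> V d ->
  exists p s, forall t, (Jconj h ((l *: y + s *: d)%R, p) <=
    (z (l *: y + s *: d) + (p (l *: y + t *: d) - z (l *: y + t *: d)) +
     (t - 1) ^+ 2 / 2 - (s - 1) ^+ 2 / 2)%:E)%E.
Proof.
move=> Py l01 Vd; have lz := dual_linear_form z.
(* The epigraph of [h] recentred at [z]: [h_ge] becomes [f w <= r]. *)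
pose B w (f : X -> R) r := exists p : dual X,
  (forall x, f x = p x - z x) /\ (h (w, p) <= (r + z w)%:E)%E.
have [|||||||g [s [lg [K gK] gB]]] := exists_saddle V B (l *: y) d V_closed V_subspace.
- move=> m w w' f f' r r' m01 [p [fE hp]] [p' [fE' hp']].
  have [c cE] := exists_dual_comb m (1 - m) p p'.
  exists c; split=> [x|]; first by rewrite cE fE fE'; ring.
  have := h_convex (w, p) (w', p') (m *: w + (1 - m) *: w', c) _ _ _ m01
    erefl cE hp hp'.
  congr (_ <= _%:E)%E.
  by rewrite (linear_formD lz) !(linear_formZ lz); ring.
- move=> w f r [p [fE _]] a u v; rewrite !fE !dual_linear; ring.
- move=> w f r [p [fE _]].
  have [c cE] := exists_dual_comb 1 (-1) p z.
  have [K _ cK] := dual_bounded c; exists K => x.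
  by rewrite fE; have := cK x; rewrite cE mul1r mulN1r.
- move=> w f r [p [fE hp]]; rewrite fE lerBlDr -lee_fin.
  exact: le_trans (h_ge (w, p)) hp.
- by move=> w f r [p [_ hp]]; apply: PrX_sub_cone; apply/PrXP; exists p, (r + z w).
- exact: Vd.
- move=> u /(PrX_core l y u l01 Py)[t t0 /PrXP[p [r hp]]].
  exists t, (fun x => p x - z x), (r - z (l *: y + t *: u)); split=> //.
  by exists p; rewrite subrK.
have [g' g'E] := exists_dual g K lg gK.
have [p pE] := exists_dual_comb 1 1 g' z.
exists p, s => t; apply/Jconj_leP => //= -[w q] r hq /=.
have := gB w (fun x => q x - z x) (r - z w) t.
rewrite !pE !mul1r !g'E => /(_ _)/=.
have : B w (fun x => q x - z x) (r - z w) by exists q; rewrite subrK.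
by move=> Bw /(_ Bw); lra.
Qed.

Lemma related_in_cone (z : X) (zs : dual X) :
  (forall q, T q -> 0 <= zs (z - q.1) - q.2 (z - q.1)) -> V z.
Proof.
move=> rel; apply: contrapT => nVz.
have [a [az aV]] := exists_annihilator V z V_closed V_subspace nVz.
have l01 : 0 <= (0 : R) < 1 by rewrite lexx ltr01.
have [p [s ps]] := Jconj_saddle zs 0 0 0 PrX0 l01 V_subspace.1.
have {ps} p0 : (Jconj h (0%R, p) <= 0%:E)%E.
  have := ps 1; rewrite !scaler0 addr0 => le; apply: le_trans le _.
  rewrite lee_fin !(linear_form0 (dual_linear_form _)).
  by have := sqr_ge0 (s - 1); lra.
(* With this multiple of [a], [zs z - q z = -1], while [(0, q)] stays in [T] because [a] vanishes on
   [V]. *)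
pose m := zs z - p z + 1.
have [q qE] := exists_dual_comb 1 m p a.
have : T (0, q).
  apply: in_T; rewrite /= (linear_form0 (dual_linear_form _)).
  apply/Jconj_leP => // -[w ws] r hw /=.
  have Vw : V w by apply: PrX_sub_cone; apply/PrXP; exists ws, r.
  rewrite qE (aV w Vw) mul1r mulr0 addr0.
  by have /Jconj_leP/(_ (w, ws) r hw) := p0; apply.
by move=> /rel; rewrite /= subr0 qE az /m; lra.
Qed.

Lemma related_in_T (z : X) (zs : dual X) :
  (forall q, T q -> 0 <= zs (z - q.1) - q.2 (z - q.1)) -> T (z, zs).
Proof.
move=> rel; have Vz := related_in_cone z zs rel; have lz := dual_linear_form zs.
apply: in_T => /=; apply/Jconj_leP => // -[y ys] r hy /=.
rewrite leNgt; apply/negP => lt.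
have /PrXP[y0 [r0 h0]] := PrX0.
have Py : PrX h y by apply/PrXP; exists ys, r.
(* The excess [a] at [(y, ys)] is positive, the excess [b] at [(0, y0)] arbitrary; the weight [e]
   below gives [(1 - e) a + e b >= a / 2]. *)
pose a := zs y + ys z - r - zs z; pose b := y0 z - r0 - zs z.
have a0 : 0 < a by rewrite /a; lra.
pose e := a / (2 * (a + `|b|)).
have ab0 : 0 < a + `|b| by rewrite ltr_pwDl.
have e0 : 0 < e by rewrite divr_gt0 // mulr_gt0.
have eab : e * (a + `|b|) = a / 2.
  by rewrite /e; field; rewrite gt_eqF.
have e1 : e <= 1 / 2.
  have h1 : 0 <= e * `|b| by rewrite mulr_ge0 // ltW.
  have : e * a <= (1 / 2) * a by lra.
  by rewrite ler_pM2r.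
pose l := 1 - e.
have l01 : 0 <= l < 1 by rewrite /l; apply/andP; split; lra.
have l01' : 0 <= l <= 1 by rewrite /l; apply/andP; split; lra.
have le : 1 - l = e by rewrite /l; ring.
have [c cE] := exists_dual_comb l e ys y0.
have hc : (h ((l *: y)%R, c) <= (l * r + e * r0)%:E)%E.
  rewrite -le; apply: (h_convex (y, ys) (0, y0) _ _ _ _ l01') hy h0 => /=.
    by rewrite scaler0 addr0.
  by move=> x; rewrite cE le.
have big : zs z < zs (l *: y) + c z - (l * r + e * r0).
  rewrite cE (linear_formZ lz).
  have : 0 < l * a + e * b.
    have : - (e * `|b|) <= e * b.
      by rewrite -mulrN ler_pM2l // lerNl ler_normr lexx orbT.
    by rewrite /l; lra.
  rewrite /a /b /l; lra.
pose d := z - l *: y.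
have Vd : V d.
  rewrite /d addrC -scaleNr; apply: V_subspace.2 => //; exact: PrX_sub_cone.
have yd : l *: y + 1 *: d = z by rewrite scale1r /d addrC subrK.
have [p [s ps]] := Jconj_saddle zs y d l Py l01 Vd.
have lp := dual_linear_form p.
pose x := l *: y + s *: d.
(* Take [t = s] in [ps]. *)
have Tx : T (x, p).
  apply: in_T => /=; apply: le_trans (ps s) _; rewrite lee_fin -/x; lra.
(* At [t = 1] the line passes through [z]; with the monotone relation between [(z, zs)] and [(x, p)]
   this forces [(s - 1) ^+ 2 <= 0]. *)
have s1 : s = 1.
  have := rel _ Tx; rewrite /= (linear_formB lz) (linear_formB lp) => r1.
  have := ps 1; rewrite -/x Tx yd /= lee_fin => r2.
  have sq : (s - 1) ^+ 2 = 0 by apply/le_anti; rewrite sqr_ge0 andbT; lra.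
  by apply/eqP; rewrite -subr_eq0 -sqrf_eq0 sq.
have xz : x = z by rewrite /x s1.
(* At [t = 1 + k] the linear part contributes [- k ^+ 2] and the quadratic part only
   [k ^+ 2 / 2]. *)
have pd : p d = zs d.
  pose k := zs d - p d.
  have td : l *: y + (1 + k) *: d = z + k *: d by rewrite scalerDl addrA yd.
  have := ps (1 + k); rewrite -/x Tx xz td /= lee_fin.
  rewrite (linear_formD lz) (linear_formD lp) (linear_formZ lz) (linear_formZ lp).
  rewrite s1 => kle.
  have kk : k * k = k * zs d - k * p d by rewrite {2}/k; ring.
  have sq : k ^+ 2 = 0 by apply/le_anti; rewrite sqr_ge0 andbT; lra.
  by apply/esym/eqP; rewrite -subr_eq0 -sqrf_eq0 -/k sq.
(* As [p] and [zs] agree on [d = z - l y], [p z - p (l y)] may be replaced by [zs z - zs (l y)],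
   which contradicts [big]. *)
have /Jconj_leP : (Jconj h (z, p) <= (p z)%:E)%E by rewrite -xz Tx.
move=> /(_ h_ge _ _ hc) /=; move: pd big.
rewrite /d (linear_formB lz) (linear_formB lp); lra.
Qed.

(** At the midpoint the duality product is at most [Jconj h], hence at most the average of its
    values at the two points; the gap is a quarter of the monotonicity expression. *)
Lemma contact_set_monotone : monotone_op T.
Proof.
move=> [x xs] [y ys] Tx Ty /=.
have [c cE] := exists_dual_comb (1 / 2) (1 - 1 / 2) xs ys.
have h01 : 0 <= (1 / 2 : R) <= 1 by apply/andP; split; lra.
have lx := dual_linear_form xs; have ly := dual_linear_form ys.
have := @Jconj_convex _ _ h h_ge (x, xs) (y, ys) ((1 / 2) *: x + (1 - 1 / 2) *: y, c)
  _ (xs x) (ys y) h01 erefl cE.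
rewrite Tx Ty => /(_ (lexx _) (lexx _)) /(le_trans (Jh_ge _)).
rewrite lee_fin /= cE !(linear_formD lx) !(linear_formD ly) !(linear_formZ lx).
rewrite !(linear_formZ ly) (linear_formN lx) (linear_formN ly); lra.
Qed.

End Maximality.

Theorem theorem3p1 (R : realType) (X : completeNormedModType R)
  (h : X * dual X -> \bar R) :
  proper_XX h -> convex_XX h ->
  (forall p : X * dual X, ((p.2 p.1)%:E <= h p)%E) ->
  (forall p : X * dual X, ((p.2 p.1)%:E <= Jconj h p)%E) ->
  closed (cone_PrX h) -> lin_subspace (cone_PrX h) ->
  let T := [set p : X * dual X | Jconj h p = (p.2 p.1)%:E] in
  maximal_monotone T /\ fitzpatrick_family T (Jconj h).
Proof.
move=> _ hc hge Jge cV sV T; split; last first.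
  by split=> //; [exact: Jconj_convex | exact: Jconj_lsc].
split=> [|S mS TS]; first exact: contact_set_monotone.
apply/seteqP; split=> // -[z zs] Sz.
by apply: related_in_T => // q /TS; exact: mS (z, zs) q Sz.
Qed.
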